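(* Let $G=(V,E)$ be a connected simple graph, let $S\subseteq V$ be a mixed resolving set of $G$, and let $x\in S$ be arbitrary. Then $|S| \geq 1 + \lceil \log_2 (1+\deg_x) \rceil$, where $\deg_x$ is the degree of $x$ in $G$.
   Context: For vertices $u,v$, $d(u,v)$ is the number of edges on a shortest $u$–$v$ path. For a vertex $w$ and an edge $e=uv$, $d(w,e)=\min(d(w,u),d(w,v))$. A vertex $w$ resolves two elements $x,y\in V\cup E$ if $d(w,x)\neq d(w,y)$. A set $S\subseteq V$ is a mixed resolving set if every pair of distinct elements of $V\cup E$ is resolved by some element of $S$. *)

(* Defs.v *)
From mathcomp Require Import all_boot all_order all_algebra.
From mathcomp Require Import reals exp.

Set Implicit Arguments.
Unset Strict Implicit.
Unset Printing Implicit Defensive.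

Lemma bigminn_le (I : finType) (P : pred I) (F : I -> nat) n j :
  P j -> \big[minn/n]_(i | P i) F i <= F j.
Proof.
move=> Pj; have := mem_index_enum j; elim: (index_enum I) => //= i s IH.
rewrite inE big_cons => /orP[/eqP <-|/IH Fj]; first by rewrite Pj geq_minl.
by case: ifP => // _; rewrite geq_min Fj orbT.
Qed.

Record sgraph := SGraph {
  svertex :> finType;
  sedge : rel svertex;
  sedge_sym : symmetric sedge;
  sedge_irr : irreflexive sedge }.

Section SimpleGraph.
Variable G : sgraph.
Implicit Types (u v w : G) (S : {set G}).

Definition edge_set : {set {set G}} :=
  [set f | [exists u, exists v, sedge u v && (f == [set u; v])]].

Definition edge := {f : {set G} | f \in edge_set}.

Definition connected_graph := forall u v, connect (@sedge G) u v.

Definition degree v : nat := #|[set u | sedge v u]|.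

(* n is the number of edges: the path is u :: p. *)
Definition has_path u v (n : nat) : bool :=
  [exists p : n.-tuple G,
    [&& path (@sedge G) u p, uniq (u :: p) & last u p == v]].

(* A path has pairwise distinct vertices, hence fewer than #|G| edges, so the
   bound on n excludes no path.  The value is #|G| if no path joins u to v. *)
Definition dist u v : nat := \big[minn/#|G|]_(n < #|G| | has_path u v n) n.

(* The default value #|G| bounds dist, so it does not affect the minimum over
   the two ends of an edge; see edge_distE. *)
Definition edge_dist w (f : edge) : nat :=
  \big[minn/#|G|]_(u in val f) dist w u.

Definition element := (G + edge)%type.

Definition elt_dist w (a : element) : nat :=
  match a with inl v => dist w v | inr f => edge_dist w f end.

Definition resolves w (a b : element) : bool := elt_dist w a != elt_dist w b.

Definition mixed_resolving S : Prop :=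
  forall a b : element, a != b -> exists2 w, w \in S & resolves w a b.

Lemma dist_le_card u v : dist u v <= #|G|.
Proof.
rewrite /dist; elim/big_ind: _ => // [m n Hm _|i _]; last exact: ltnW.
by rewrite geq_min Hm.
Qed.

Lemma edge_distE w (f : edge) u v :
  val f = [set u; v] -> edge_dist w f = minn (dist w u) (dist w v).
Proof.
move=> fE; apply/eqP; rewrite eqn_leq /edge_dist fE; apply/andP; split.
  rewrite leq_min; apply/andP; split; apply: bigminn_le.
    by rewrite !inE eqxx.
  by rewrite !inE eqxx orbT.
elim/big_ind: _ => [|m n Hm Hn|t].
- by rewrite geq_min dist_le_card.
- by rewrite leq_min Hm.
- by rewrite !inE => /orP[] /eqP ->; rewrite geq_min leqnn ?orbT.
Qed.

End SimpleGraph.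

Definition log2 (R : realType) (x : R) : R := (ln x / ln 2)%R.

(* Main.v *)
Require Import Defs.
From mathcomp Require Import all_boot all_order all_algebra.
From mathcomp Require Import reals exp.

(** Consider [x] together with the edges at [x]: these are [1 + deg x] elements.
    A vertex [w] sees each of them at distance [d(w,x)] or [d(w,x) - 1], and
    [w = x] sees all of them at distance [0]. Hence the members of [S] other
    than [x] give these elements pairwise distinct binary codes, so that
    [1 + deg x <= 2 ^ (|S| - 1)]. *)

Set Implicit Arguments.
Unset Strict Implicit.
Unset Printing Implicit Defensive.

Section Graph.
Variable G : sgraph.
Implicit Types (u v w x : G) (S : {set G}).

Definition nbhd x : {set G} := [set u | sedge x u].

Lemma dist_refl x : dist x x = 0.
Proof.
have n0 : 0 < #|G| by apply/card_gt0P; exists x.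
apply/eqP; rewrite -leqn0.
apply: (bigminn_le _ _ (j := Ordinal n0)).
by apply/existsP; exists [tuple]; rewrite /= eqxx.
Qed.

Lemma dist_le_path w p :
  path (@sedge G) w p -> uniq (w :: p) -> dist w (last w p) <= size p.
Proof.
move=> wp Up; have lt_p : size p < #|G|.
  by rewrite -[_.+1]/(size (w :: p)) -(card_uniqP Up) max_card.
apply: (bigminn_le _ _ (j := Ordinal lt_p)).
by apply/existsP; exists (in_tuple p); rewrite wp Up eqxx.
Qed.

(** A simple path from [w] to [u], extended by [v], may revisit a vertex, so it is first shortened
    to a simple path, which cannot be longer. *)
Lemma dist_edge w u v : sedge u v -> dist w v <= (dist w u).+1.
Proof.
move=> uv; rewrite {2}/dist; elim/big_ind: _ => [|m n Hm Hn|i].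
(* The default value [#|G|] of the minimum, reached when no path joins [w] to [u]. *)
- exact: leq_trans (dist_le_card w v) (leqnSn _).
- by rewrite /minn; case: ifP.
case/existsP=> p /and3P[wp _ /eqP pu].
have wpv : path (@sedge G) w (rcons p v) by rewrite rcons_path wp pu.
case/shortenP: wpv (last_rcons w p v) => q wq Uq sub_q qv.
rewrite -{1}qv; apply: leq_trans (dist_le_path wq Uq) _.
have /andP[_ Uq'] := Uq.
by have := uniq_leq_size Uq' sub_q; rewrite size_rcons size_tuple.
Qed.

(* The default [inl x] is the intended value at [v = x], where [[set x; v]] is a
   singleton and not an edge. *)
Definition star x v : element G :=
  if insub [set x; v] is Some f then inr f else inl x.

Lemma star_self x : star x x = inl x.
Proof.
rewrite /star setUid insubF //; apply/negbTE/negP; rewrite inE.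
case/existsP=> u /existsP[v /andP[uv /eqP E]].
have /set1P ux : u \in [set x] by rewrite E set21.
have /set1P vx : v \in [set x] by rewrite E set22.
by rewrite ux vx sedge_irr in uv.
Qed.

Lemma star_edge x v :
  sedge x v -> exists2 f : edge G, star x v = inr f & val f = [set x; v].
Proof.
move=> xv; have Ef : [set x; v] \in edge_set G.
  by rewrite inE; apply/existsP; exists x; apply/existsP; exists v; rewrite xv /=.
by rewrite /star; case: insubP => [f _ fE|]; [exists f | rewrite Ef].
Qed.

(** An edge at [x] determines its other end, as there are no loops. *)
Lemma star_inj x : {in x |: nbhd x &, injective (star x)}.
Proof.
have nx v : sedge x v -> v != x.
  by apply: contraTneq => ->; rewrite sedge_irr.
move=> u v; rewrite !inE => /orP[/eqP-> | xu] /orP[/eqP-> | xv] //.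
- by have [f -> _] := star_edge xv; rewrite star_self.
- by have [f -> _] := star_edge xu; rewrite star_self.
have [f -> fE] := star_edge xu; have [g -> gE] := star_edge xv => -[fg].
have : u \in [set x; v] by rewrite -gE -fg fE set22.
by rewrite !inE (negbTE (nx u xu)) => /eqP.
Qed.

(** The nearer end of [xv] gives the distance, and [dist w x] exceeds [dist w v] by at most one; the
    subtracted boolean is thus the one bit that [w] reads. *)
Lemma elt_dist_star x v w : v \in x |: nbhd x ->
  elt_dist w (star x v) = dist w x - (dist w v < dist w x).
Proof.
rewrite !inE => /orP[/eqP-> | xv]; first by rewrite star_self ltnn subn0.
have [f -> /edge_distE /= ->] := star_edge xv.
have := dist_edge w (etrans (sedge_sym v x) xv).
case: ltnP => [lt_vx le_xv | _ _]; last by rewrite subn0.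
have -> : dist w x = (dist w v).+1 by apply/eqP; rewrite eqn_leq le_xv.
by rewrite subn1.
Qed.

Definition code S x v : {set G} := [set w in S :\ x | dist w v < dist w x].

Lemma code_inj S x :
  mixed_resolving S -> {in x |: nbhd x &, injective (code S x)}.
Proof.
move=> resS u v Nu Nv eq_code; apply/eqP/negPn/negP => neq_uv.
have /resS[w wS] : star x u != star x v.
  by apply: contra neq_uv => /eqP/star_inj->.
rewrite /resolves !elt_dist_star //; case/negP.
(* At [w = x] both sides are truncated subtractions from 0, so [x] contributes no bit. *)
have [-> | wx] := eqVneq w x; first by rewrite dist_refl.
by have /setP/(_ w) := eq_code; rewrite !inE wx wS /= => ->.
Qed.

Lemma degree_lt_exp S x : mixed_resolving S ->
  1 + degree x <= 2 ^ #|S :\ x|.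
Proof.
move=> resS; have -> : 1 + degree x = #|x |: nbhd x|.
  by rewrite cardsU1 inE sedge_irr.
(* Distinct codes are distinct subsets of [S :\ x]. *)
rewrite -(card_in_imset (code_inj resS)) -card_powerset.
apply/subset_leq_card/subsetP => _ /imsetP[v _ ->].
by rewrite inE; apply/subsetP => w; rewrite inE => /andP[].
Qed.

End Graph.

Import Order.TTheory GRing.Theory Num.Theory.

Lemma ceil_log2_le (R : realType) (m n : nat) :
  0 < m -> m <= 2 ^ n -> (Num.ceil (log2 (m%:R : R)) <= n%:Z)%R.
Proof.
move=> m0 le_mn; rewrite ceil_le_int /log2.
have ln2 : (0 < ln 2 :> R)%R by rewrite ln_gt0 ?ltr1n.
rewrite ler_pdivrMr // -[(n%:Z%:~R)%R]/(n%:R : R)%R mulr_natl -lnXn ?ltr0n //.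
by rewrite ler_ln ?posrE ?exprn_gt0 ?ltr0n // -natrX ler_nat.
Qed.

Theorem theorem2 (R : realType) (G : sgraph) (S : {set G}) (x : G) :
  connected_graph G -> mixed_resolving S -> x \in S ->
  (1 + Num.ceil (log2 (1 + (degree x)%:R : R)) <= #|S|%:Z)%R.
Proof.
(* The summand 1 in the bound is [x] itself, split off from [S]. *)
move=> _ resS xS; rewrite (cardsD1 x) xS PoszD lerD2l nat1r.
exact: ceil_log2_le (degree_lt_exp x resS).
Qed.
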